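(* Let $q$ be a prime power, $2\le n\le m$ integers, $\mathcal{C}\le\mathbb{F}_q^{n\times m}$ an $\mathbb{F}_q$-linear subspace of dimension $k$, and $0\le i\le k$. Suppose $\mathcal{C}$ is $i$-BMD. Then for all $i\le j\le k$ and $0\le u\le n$, $$B_u^{(j)}(\mathcal{C})=\begin{cases}0&\text{if } u<d_j,\\ \begin{bmatrix} n \\ u \end{bmatrix}_q\begin{bmatrix} k-m(n-u) \\ j \end{bmatrix}_q&\text{if } u\ge d_j.\end{cases}$$
   Context: The dual is $\mathcal{C}^\perp=\{N\in\mathbb{F}_q^{n\times m}:\operatorname{Tr}(MN^t)=0\ \forall M\in\mathcal{C}\}$; $d^\perp$ is the minimum rank of a nonzero element of $\mathcal{C}^\perp$, and $d^\perp=n+1$ if $\mathcal{C}^\perp=\{0\}$. An optimal anticode is a subspace $A\le\mathbb{F}_q^{n\times m}$ with $\dim A=m\cdot\max\{\operatorname{rk}(M):M\in A\}$, and for $0\le j\le k$, $d_j=\frac1m\min\{\dim A: A\text{ an optimal anticode},\ \dim(A\cap\mathcal{C})\ge j\}$. $\mathcal{C}$ is $i$-BMD if $n-d^\perp-d_i<0$. For integers $a,b$, $\begin{bmatrix} a \\ b \end{bmatrix}_q$ is $0$ if $b<0$ or $0\le a<b$; $1$ if $b=0$; $\prod_{s=1}^b\frac{q^{a-s+1}-1}{q^s-1}$ if $b>0$, $a\ge b$; $(-1)^bq^{ab-\binom b2}\begin{bmatrix} -a+b-1 \\ b \end{bmatrix}_q$ if $b>0$, $a<0$. For $U\le\mathbb{F}_q^n$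 let $\mathcal{C}(U)$ (respectively, if $n=m$, $\mathcal{C}[U]$) be the set of $M\in\mathcal{C}$ with column space (respectively row space) contained in $U$. For $0\le u\le n$, $B_u^{(j)}(\mathcal{C})=\sum_{\dim U=u}\begin{bmatrix} \dim\mathcal{C}(U) \\ j \end{bmatrix}_q$ if $n<m$, and $B_u^{(j)}(\mathcal{C})=\frac12\sum_{\dim U=u}\Big(\begin{bmatrix} \dim\mathcal{C}(U) \\ j \end{bmatrix}_q+\begin{bmatrix} \dim\mathcal{C}[U] \\ j \end{bmatrix}_q\Big)$ if $n=m$ (sums over $U\le\mathbb{F}_q^n$). *)

(* Defs.v *)
From HB Require Import structures.
From mathcomp Require Import all_boot all_order all_algebra.

Set Implicit Arguments.
Unset Strict Implicit.
Unset Printing Implicit Defensive.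

Import Order.TTheory GRing.Theory Num.Theory.
Local Open Scope ring_scope.

(* Subspaces of a vector space over a finite field form a finite type, which
   allows sums over all subspaces. *)
HB.instance Definition _ (F : finFieldType) (vT : vectType F) :=
  CanIsCountable (@VectorInternalTheory.vs2mxK F vT).
HB.instance Definition _ (F : finFieldType) (vT : vectType F) : isFinite {vspace vT} :=
  CanIsFinite (@VectorInternalTheory.vs2mxK F vT).

(* The product formula for the q-binomial coefficient, meant for 0 < b <= a. *)
Definition qbin_prod (q : nat) (a : int) (b : nat) : rat :=
  \prod_(1 <= s < b.+1) ((q%:R ^ (a - s%:Z + 1) - 1) / (q%:R ^+ s - 1)).

(* For b > 0 and a < 0 one has - a + b - 1 >= b, so the coefficient with upper
   index - a + b - 1 is itself given by the product formula. *)
Definition qbin (q : nat) (a b : int) : rat :=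
  if (b < 0) || (0 <= a < b) then 0
  else if b == 0 then 1
  else if b <= a then qbin_prod q a `|b|
  else (-1) ^+ `|b| * q%:R ^ (a * b - 'C(`|b|, 2)%:Z)
       * qbin_prod q (- a + b - 1) `|b|.

Section RankMetricCode.
Variables (F : finFieldType) (n m : nat).
Implicit Types (C A : {vspace 'M[F]_(n, m)}) (M N : 'M[F]_(n, m)).

Definition dual_code C : {set 'M[F]_(n, m)} :=
  [set N | [forall M in C, \tr (M *m N^T) == 0]].

(* Ranks are at most n, so the default value n + 1 of the minimum is attained
   only if the dual is zero. *)
Definition dual_min_dist C : nat :=
  \big[minn/n.+1]_(N in dual_code C | N != 0) \rank N.

Definition max_rank A : nat := \max_(M in A) \rank M.

Definition optimal_anticode A : bool := \dim A == (m * max_rank A)%N.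

(* For n <= m and j <= \dim C the full matrix space, of dimension n * m, is an
   optimal anticode meeting C in dimension at least j, so the default value
   does not affect the minimum; the division by m is exact because the
   dimension of an optimal anticode is a multiple of m. *)
Definition gen_weight C (j : nat) : nat :=
  ((\big[minn/(n * m)%N]_(A : {vspace 'M[F]_(n, m)}
       | optimal_anticode A && (j <= \dim (A :&: C))%N) \dim A) %/ m)%N.

Definition BMD (i : nat) C : bool :=
  n%:Z - (dual_min_dist C)%:Z - (gen_weight C i)%:Z < 0.

End RankMetricCode.

Definition rowspace (F : fieldType) (a b : nat) (M : 'M[F]_(a, b)) :
  {vspace 'rV[F]_b} := <<[seq row i M | i : 'I_a]>>%VS.

(* Column vectors are transposed, so that both row and column spaces consist
   of row vectors. *)
Definition colspace (F : fieldType) (a b : nat) (M : 'M[F]_(a, b)) :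
  {vspace 'rV[F]_a} := rowspace M^T.

Lemma rowspace_subv (F : fieldType) (a b : nat) (M : 'M[F]_(a, b))
    (U : {vspace 'rV[F]_b}) :
  (rowspace M <= U)%VS = [forall i, row i M \in U].
Proof.
apply/span_subvP/forallP => [sU i | sU _ /imageP[i _ ->]]; last exact: sU.
by apply: sU; apply: image_f.
Qed.

Lemma rowspace_subv_submod (F : fieldType) (a b : nat)
    (U : {vspace 'rV[F]_b}) :
  submod_closed [pred M : 'M[F]_(a, b) | (rowspace M <= U)%VS].
Proof.
split=> [|c M N]; rewrite !inE !rowspace_subv.
  by apply/forallP=> i; rewrite row0 mem0v.
move=> MU NU; apply/forallP=> i.
by rewrite linearP rpredD ?rpredZ ?(forallP MU) ?(forallP NU).
Qed.

Lemma mem_span_submod (F : finFieldType) (n m : nat)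
    (C : {vspace 'M[F]_(n, m)}) (P : pred 'M[F]_(n, m)) M :
  submod_closed [pred N | P N] ->
  (M \in <<enum [set N in C | P N]>>%VS) = (M \in C) && P M.
Proof.
move=> [P0 PD]; apply/idP/andP => [|[MC MP]]; last first.
  by apply: memv_span; rewrite mem_enum inE MC.
move=> /(@coord_span _ _ _ (in_tuple _)) ->; apply/andP.
elim/big_rec: _ => [|i N _ /andP[NC NP]]; first by rewrite mem0v.
have /[!(mem_enum, inE)] /andP[xC xP] := mem_nth 0 (ltn_ord i).
by rewrite rpredD ?rpredZ //=; apply: PD.
Qed.

Section Shortening.
Variables (F : finFieldType) (n m : nat).
Implicit Types (C : {vspace 'M[F]_(n, m)}) (U : {vspace 'rV[F]_n}).

(* The spanning sets in col_short and row_short are already subspaces, see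
   mem_col_short and mem_row_short; taking spans turns them into terms of type
   vspace. *)
Definition col_short C U : {vspace 'M[F]_(n, m)} :=
  <<enum [set M in C | (colspace M <= U)%VS]>>%VS.

(* Meant for n = m, where conform_mx 0 M is M with its type cast from
   'M_(n, m) to 'M_n. *)
Definition row_short C U : {vspace 'M[F]_(n, m)} :=
  <<enum [set M in C | (rowspace (conform_mx (0 : 'M[F]_n) M) <= U)%VS]>>%VS.

Lemma mem_col_short C U M :
  (M \in col_short C U) = (M \in C) && (colspace M <= U)%VS.
Proof.
apply: (@mem_span_submod F n m C (fun M => colspace M <= U)%VS).
have [h0 h1] := @rowspace_subv_submod F m n U.
split=> [|c A B hA hB]; first by rewrite inE /colspace trmx0.
by rewrite inE /colspace linearP; apply: h1.
Qed.

(* Meant for n <= m: the last case is n = m. *)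
Definition binomial_moment C (j u : nat) : rat :=
  if (n < m)%N then
    \sum_(U : {vspace 'rV[F]_n} | \dim U == u)
      qbin #|F| (\dim (col_short C U))%:Z j%:Z
  else
    2%:R^-1 * \sum_(U : {vspace 'rV[F]_n} | \dim U == u)
      (qbin #|F| (\dim (col_short C U))%:Z j%:Z
       + qbin #|F| (\dim (row_short C U))%:Z j%:Z).

End Shortening.

Lemma mem_row_short (F : finFieldType) (n : nat) (C : {vspace 'M[F]_n})
    (U : {vspace 'rV[F]_n}) (M : 'M[F]_n) :
  (M \in row_short C U) = (M \in C) && (rowspace M <= U)%VS.
Proof.
rewrite (@mem_span_submod F n n C
  (fun M => rowspace (conform_mx (0 : 'M[F]_n) M) <= U)%VS).
  by rewrite conform_mx_id.
have [h0 h1] := @rowspace_subv_submod F n n U.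
by split=> [|c A B]; rewrite !inE !conform_mx_id //; apply: h1.
Qed.

(* Main.v *)
(* Let A_U be the space of matrices with column (or row) space in U, dim U = u;
   it is an optimal anticode of dimension m u and maximum rank u.  If u < d_j,
   then dim (C :&: A_U) < j.  If u >= d_j >= d_i, then n - u < d^perp by the
   i-BMD hypothesis, and a nonzero matrix orthogonal to C + A_U would be an
   element of the dual code of rank at most n - u; hence C + A_U is the full
   matrix space and dim (C :&: A_U) = k - m (n - u) for each of the
   [n choose u]_q subspaces U. *)
Require Import Defs.
From HB Require Import structures.
From mathcomp Require Import all_boot all_order all_algebra.
Import Order.TTheory GRing.Theory Num.Theory.
Local Open Scope ring_scope.

(** * Row spaces as subspaces of the space of row vectors *)

Lemma memv_rowspace (F : fieldType) (a b : nat) (B : 'M[F]_(a, b)) (v : 'rV[F]_b) :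
  (v \in rowspace B) = (v <= B)%MS.
Proof.
apply/idP/idP => [|/submxP[D ->]].
  move=> /(@coord_span _ _ _ (in_tuple _)) ->.
  apply: summx_sub => i _; apply: scalemx_sub.
  have /imageP[j _ ->] := mem_nth 0 (ltn_ord i).
  exact: row_sub.
rewrite mulmx_sum_row; apply: rpred_sum => i _.
by apply: rpredZ; apply: memv_span; apply: image_f.
Qed.

Lemma rowspace_subvE (F : fieldType) (a b c : nat) (M : 'M[F]_(a, b)) (B : 'M[F]_(c, b)) :
  (rowspace M <= rowspace B)%VS = (M <= B)%MS.
Proof.
rewrite rowspace_subv; apply/forallP/row_subP => h i.
  by rewrite -memv_rowspace.
by rewrite memv_rowspace.
Qed.

(** Multiplication by [row_base B] parametrizes the row space injectively by row vectors of length
    [\rank B]. *)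
Lemma dim_rowspace (F : fieldType) (a b : nat) (B : 'M[F]_(a, b)) :
  \dim (rowspace B) = \rank B.
Proof.
have -> : rowspace B = limg (linfun (mulmxr (row_base B) : 'rV_(\rank B) -> 'rV_b)).
  apply/vspaceP => v; rewrite memv_rowspace -(eq_row_base B).
  apply/submxP/memv_imgP => [[D ->]|[D _ ->]]; exists D; rewrite ?memvf ?lfunE //.
rewrite limg_dim_eq ?dimvf /dim /= ?mul1n //.
apply/eqP; rewrite capfv; apply/lker0P => x y; rewrite !lfunE /=.
exact: row_free_inj (row_base_free B) _ _.
Qed.

Lemma rowspace_basis {F : fieldType} {b u : nat} {U : {vspace 'rV[F]_b}} :
  \dim U = u -> exists2 B : 'M[F]_(u, b), row_free B & rowspace B = U.
Proof.
case: u / .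
pose B := \matrix_(i < \dim U) (vbasis U)`_i.
have BU : rowspace B = U.
  rewrite -[RHS](span_basis (vbasisP U)) /rowspace; congr (<<_>>%VS).
  apply: (@eq_from_nth _ 0) => [|i].
    by rewrite size_image card_ord size_tuple.
  rewrite size_image => ib; have iU : (i < \dim U)%N by rewrite card_ord in ib.
  by rewrite (nth_map (Ordinal iU)) -?cardE // -[i]/(val (Ordinal iU)) nth_ord_enum rowK.
by exists B; rewrite // /row_free -dim_rowspace BU.
Qed.

(** * Counting subspaces over a finite field *)

Section GaussianBinomial.
Variables (F : finFieldType).
Local Notation q := #|F|.

Lemma card_submx_free (a b : nat) (B : 'M[F]_(a, b)) :
  row_free B -> #|[set v : 'rV[F]_b | (v <= B)%MS]| = (q ^ a)%N.
Proof.
move=> fB; rewrite -[a in RHS]mul1n -card_mx -(card_imset _ (row_free_inj fB)).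
congr #|pred_of_set _|; apply/setP => v; rewrite inE.
by apply/submxP/imsetP => [[D ->]|[D _ ->]]; exists D.
Qed.

Lemma row_free_col_mx1 (a b : nat) (v : 'rV[F]_b) (B : 'M[F]_(a, b)) :
  row_free (col_mx v B) = row_free B && ~~ (v <= B)%MS.
Proof.
have := mxrank_sum_cap v B; rewrite /row_free -addsmxE.
have [vB|nvB] := boolP (v <= B)%MS; last first.
  have v0 : v != 0 by apply: contraNneq nvB => ->; rewrite sub0mx.
  (* The intersection is a proper subspace of the line spanned by [v]. *)
  have -> : \rank (v :&: B)%MS = 0%N.
    have := ltn_leqif (mxrank_leqif_sup (capmxSl v B)).
    by rewrite sub_capmx submx_refl nvB rank_rV v0 ltnS leqn0 => /eqP.
  by rewrite addn0 rank_rV v0 andbT => ->; rewrite eqn_add2l.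
move=> _; rewrite andbF; apply/negbTE.
rewrite (addsmx_idPr vB) neq_ltn ltnS; apply/orP; left.
exact: rank_leq_row.
Qed.

(** Induction on [a]: the row space of a free matrix with [a] rows has [q ^ a] elements, so a new
    top row can be chosen in [q ^ b - q ^ a] ways. *)
Lemma card_row_free (a b : nat) :
  #|[set B : 'M[F]_(a, b) | row_free B]| = (\prod_(i < a) (q ^ b - q ^ i))%N.
Proof.
elim: a => [|a IHa].
  rewrite big_ord0 -(cards1 (0 : 'M[F]_(0, b))); congr #|pred_of_set _|.
  by apply/setP => B; rewrite !inE flatmx0 eqxx /row_free mxrank0.
rewrite big_ord_recr /= -IHa.
rewrite -!sum1dep_card big_distrl /=.
rewrite (reindex (fun p : 'M[F]_(a, b) * 'rV[F]_b =>
  col_mx p.2 p.1 : 'M_(1 + a, b))) /=; last first.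
  exists (fun M : 'M_(1 + a, b) => (dsubmx M, usubmx M)) => [[B v]|M] _ /=.
    by rewrite col_mxKd col_mxKu.
  by rewrite vsubmxK.
under eq_bigl do rewrite row_free_col_mx1.
rewrite -(pair_big_dep (fun B : 'M[F]_(a, b) => row_free B)
  (fun B v => ~~ (v <= B)%MS) (fun _ _ => 1%N)) /=.
apply: eq_bigr => B fB; rewrite mul1n sum1dep_card -(card_submx_free _ _ _ fB).
have -> : (q ^ b)%N = #|[set: 'rV[F]_b]| by rewrite cardsT card_mx mul1n.
rewrite cardsT -(cardsC [set v : 'rV[F]_b | (v <= B)%MS]) addKn.
by congr #|pred_of_set _|; apply/setP => v; rewrite !inE.
Qed.

(** Double count of the full-rank matrices by row space: those sharing the row space of a fixed [B0]
    are the [X *m B0] with [X] invertible. *)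
Lemma card_subspaces_mul (b u : nat) :
  (#|[set U : {vspace 'rV[F]_b} | \dim U == u]| * (\prod_(i < u) (q ^ u - q ^ i))
   = \prod_(i < u) (q ^ b - q ^ i))%N.
Proof.
rewrite -!card_row_free -[in RHS]sum1dep_card.
rewrite (partition_big (@rowspace F u b) (fun U => \dim U == u)) /=; last first.
  by move=> B; rewrite dim_rowspace.
rewrite -sum1dep_card big_distrl /=; apply: eq_bigr => U /eqP /rowspace_basis[B0 fB0 <-].
rewrite mul1n sum1dep_card -(card_imset _ (row_free_inj fB0)).
congr #|pred_of_set _|; apply/setP => B; rewrite !inE.
apply/imsetP/andP => [[X]|[fB /eqP BU]].
  rewrite inE => fX ->; split.
    by rewrite /row_free mxrankMfree.
  rewrite eqEdim rowspace_subvE submxMl !dim_rowspace mxrankMfree //.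
  by rewrite (eqP fX) (eqP fB0) /=.
have : (B <= B0)%MS by rewrite -rowspace_subvE BU.
case/submxP => X eB; exists X => //; rewrite inE.
by move: fB; rewrite eB /row_free mxrankMfree.
Qed.

Lemma card_subspaces (b u : nat) : (u <= b)%N ->
  #|[set U : {vspace 'rV[F]_b} | \dim U == u]|%:R = qbin q b%:Z u%:Z.
Proof.
move=> ub; have q1 : (1 < q)%N := card_finNzRing_gt1 F.
have qq (c : nat) : (u <= c)%N ->
    (\prod_(i < u) (q ^ c - q ^ i))%N%:R
    = (\prod_(i < u) q%:R ^+ i) * \prod_(i < u) (q%:R ^+ (c - i) - 1) :> rat.
  move=> uc; rewrite natr_prod -big_split; apply: eq_bigr => i _ /=.
  have ic : (i <= c)%N by rewrite (leq_trans _ uc) // ltnW.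
  rewrite natrB ?leq_exp2l // !natrX mulrBr mulr1 -exprD subnKC //.
have qX (s : nat) : (0 < s)%N -> q%:R ^+ s - 1 != 0 :> rat.
  by move=> s0; rewrite subr_eq0 -natrX pnatr_eq1 -(expn0 q) eqn_exp2l // -lt0n.
have q0 : \prod_(i < u) q%:R ^+ i != 0 :> rat.
  by apply/prodf_neq0 => i _; rewrite expf_neq0 // pnatr_eq0 -lt0n ltnW.
have p0 : \prod_(i < u) (q%:R ^+ (u - i) - 1) != 0 :> rat.
  by apply/prodf_neq0 => i _; rewrite qX // subn_gt0.
(* At [u = 0] the value 1 of [qbin] is the empty product, so the product formula covers this case
   too. *)
have -> : qbin q b u = qbin_prod q b u.
  rewrite /qbin !ltz_nat !lez_nat (ltnNge b) ub /=.
  by case: u {ub qq q0 p0} => [|u] //; rewrite /qbin_prod big_nil.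
have /(congr1 (fun x => x%:R : rat)) := card_subspaces_mul b u.
rewrite natrM !qq // mulrCA => /(mulfI q0) e.
rewrite /qbin_prod big_add1 big_mkord /= prodf_div.
(* The two denominators have the same factors in opposite order. *)
have -> : \prod_(i < u) (q%:R ^+ i.+1 - 1) = \prod_(i < u) (q%:R ^+ (u - i) - 1) :> rat.
  by rewrite (reindex_inj rev_ord_inj); apply: eq_bigr => i _; rewrite /= subnSK.
apply: (mulIf p0); rewrite mulfVK // {}e.
apply: eq_bigr => i _; congr (_ - _).
have ib : (i <= b)%N by rewrite (leq_trans _ ub) // ltnW.
by rewrite exprnP -subzn // intS opprD addrA addrAC subrK.
Qed.
End GaussianBinomial.

(** * Trace duality, generalized weights and anticodes *)

Lemma bigminn_leq (I : finType) (P : pred I) (E : I -> nat) (i : I) (d : nat) :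
  P i -> (\big[minn/d]_(k | P k) E k <= E i)%N.
Proof.
move=> Pi; have := mem_index_enum i.
elim: (index_enum I) => // k r IHr; rewrite inE big_cons => /predU1P[<-|/IHr ir].
  by rewrite Pi geq_minl.
by case: ifP => // _; rewrite geq_min ir orbT.
Qed.

Section Anticodes.
Variables (F : finFieldType) (n m u : nat).
Implicit Types C A : {vspace 'M[F]_(n, m)}.

(** Pairing with a basis of [C] under the trace form is a linear map to a space of dimension
    [\dim C]; when [C] is proper, its kernel is nonzero for dimension reasons. *)
Lemma proper_dual C : C != fullv ->
  exists2 N : 'M[F]_(n, m), N != 0 & forall M, M \in C -> \tr (M *m N^T) = 0.
Proof.
move=> nC; pose f (N : 'M[F]_(n, m)) := \row_(i < \dim C) \tr ((vbasis C)`_i *m N^T).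
have lf : linear f.
  move=> c M N; apply/rowP => i; rewrite !mxE linearP /= mulmxDr -scalemxAr.
  by rewrite linearP.
pose fL : {linear 'M[F]_(n, m) -> 'rV[F]_(\dim C)} :=
  HB.pack f (GRing.isLinear.Build _ _ _ _ f lf).
pose g := linfun fL.
have : lker g != 0%VS.
  apply: contra nC => /eqP g0; have := limg_ker_dim g fullv.
  rewrite g0 capv0 dimv0 add0n => e.
  rewrite eqEdim subvf -e (leq_trans (dimvS (subvf _))) // dimvf /dim /= mul1n //.
rewrite -vpick0 => N0; exists (vpick (lker g)) => // M MC.
have := memv_pick (lker g); rewrite memv_ker lfunE /= => /eqP fN.
rewrite (coord_vbasis MC) mulmx_suml linear_sum big1 // => i _.
rewrite -scalemxAl linearZ /=.
by have := congr1 (fun v : 'rV_ _ => v 0 i) fN; rewrite !mxE => ->; rewrite mulr0.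
Qed.

Lemma gen_weight_cap A C j : optimal_anticode A -> (0 < m)%N ->
  (j <= \dim (C :&: A))%N -> (gen_weight C j <= max_rank A)%N.
Proof.
move=> oA m0 jA; rewrite -(mulKn (max_rank A) m0) -(eqP oA).
apply/leq_div2r/(@bigminn_leq _ _ (fun A => \dim A)).
by rewrite oA capvC.
Qed.

Lemma gen_weightS C i j : (i <= j)%N -> (gen_weight C i <= gen_weight C j)%N.
Proof.
move=> ij; apply: leq_div2r.
apply: (big_ind (fun x => _ <= x)%N).
(* The minimum for [j] starts from the default [n * m], which must therefore bound the minimum for
   [i]. *)
- elim/big_ind: _ => // [x y hx _|A _]; first by rewrite geq_min hx.
  by rewrite (leq_trans (dimvS (subvf A))) ?dimvf.
- by move=> x y hx hy; rewrite leq_min hx.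
move=> A /andP[oA jA].
by apply: (@bigminn_leq _ _ (fun A => \dim A)); rewrite oA (leq_trans ij).
Qed.

Lemma dual_min_dist_le C N : N \in dual_code C -> N != 0 ->
  (dual_min_dist C <= \rank N)%N.
Proof. by move=> NC N0; apply: (@bigminn_leq _ _ (fun N => \rank N)); rewrite NC. Qed.

(** The hypothesis on [N] bounds the ranks in the dual of [A] by [n - u], so the duals of [A] and
    [C] meet only in zero and [C + A] is everything. *)
Lemma dim_cap_anticode A C : \dim A = (m * u)%N -> (u <= n)%N ->
  (forall N, (forall M, M \in A -> \tr (M *m N^T) = 0) -> (\rank N <= n - u)%N) ->
  (n - u < dual_min_dist C)%N ->
  (\dim (C :&: A))%:Z = (\dim C)%:Z - m%:Z * (n%:Z - u%:Z).
Proof.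
move=> dA un rA dC.
have CA : (C + A)%VS = fullv.
  apply/eqP; apply: contraTT dC => /proper_dual[N N0 NCA].
  rewrite -leqNgt; apply: leq_trans (rA N _) => [|M MA].
    apply: dual_min_dist_le N0; rewrite inE; apply/forall_inP => M MC.
    by rewrite NCA // (subvP (addvSl _ _)).
  by rewrite NCA // (subvP (addvSr _ _)).
have := dimv_sum_cap C A; rewrite CA dimvf /dim /= dA => e.
apply/eqP; rewrite eq_sym subr_eq subzn // -PoszM -PoszD eqz_nat.
by rewrite -(eqn_add2r (m * u)) -addnA -mulnDr subnK // -e addnC (mulnC m) !eqxx.
Qed.

Variable f : {linear 'M[F]_(m, u) -> 'M[F]_(n, m)}.
Hypotheses (um : (u <= m)%N) (f_rank : forall X, \rank (f X) = \rank X).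

(** Only the zero matrix has rank 0, so a rank-preserving linear map is injective. *)
Lemma dim_limg_rank : \dim (limg (linfun f)) = (m * u)%N.
Proof.
rewrite limg_dim_eq ?dimvf //; apply/eqP; rewrite capfv -subv0.
apply/subvP => X; rewrite memv_ker memv0 lfunE /= => /eqP fX.
by rewrite -mxrank_eq0 -f_rank fX mxrank0.
Qed.

Lemma max_rank_limg : max_rank (limg (linfun f)) = u.
Proof.
apply/eqP; rewrite eqn_leq; apply/andP; split.
  apply/bigmax_leqP => M /memv_imgP[X _ ->]; rewrite lfunE f_rank.
  exact: rank_leq_col.
(* Since [u <= m], the matrix [pid_mx u] has rank [u], and its image attains the bound. *)
have := @leq_bigmax_cond _ (mem (limg (linfun f))) (fun M => \rank M) (f (pid_mx u)).
rewrite f_rank rank_pid_mx // => -> //.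
by apply/memv_imgP; exists (pid_mx u); rewrite ?memvf ?lfunE.
Qed.

Lemma optimal_anticode_limg : optimal_anticode (limg (linfun f)).
Proof. by rewrite /optimal_anticode dim_limg_rank max_rank_limg. Qed.

End Anticodes.

(** * Dimensions of shortened codes and the binomial moments *)

Lemma tr_mulmx_eq0 (F : fieldType) (a b : nat) (Y : 'M[F]_(a, b)) :
  (forall X : 'M[F]_(b, a), \tr (X *m Y) = 0) -> Y = 0.
Proof.
move=> h; apply/matrixP => i j; rewrite mxE -[RHS](h (delta_mx j i)).
rewrite /mxtrace (bigD1 j) //= mxE (bigD1 i) //= mxE !eqxx mul1r.
rewrite !big1 ?addr0 // => [k kj | l li].
  by rewrite mxE big1 // => l _; rewrite mxE (negbTE kj) mul0r.
by rewrite mxE (negbTE li) andbF mul0r.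
Qed.

(* f parametrizes the anticode A_U: it is X |-> (X B)^T for column spaces and
   X |-> X B for row spaces, where the rows of B form a basis of U. *)
Lemma qbin_short (F : finFieldType) (n m u i j : nat) (C D : {vspace 'M[F]_(n, m)})
  (f : {linear 'M[F]_(m, u) -> 'M[F]_(n, m)}) :
  (0 < m)%N -> (u <= n)%N -> (u <= m)%N -> (i <= j)%N -> BMD i C ->
  (forall X, \rank (f X) = \rank X) ->
  (forall N, (forall X, \tr (f X *m N^T) = 0) -> (\rank N <= n - u)%N) ->
  (forall M, M \in D = (M \in C) && (M \in limg (linfun f))) ->
  qbin #|F| (\dim D)%:Z j%:Z =
  if (u < gen_weight C j)%N then 0
  else qbin #|F| ((\dim C)%:Z - m%:Z * (n%:Z - u%:Z)) j%:Z.
Proof.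
move=> m0 un um ij bmd rf df DE.
have -> : D = (C :&: limg (linfun f))%VS by apply/vspaceP => M; rewrite DE memv_cap.
case: ltnP => uj.
  (* If [\dim D] reached [j], the anticode would witness that the [j]-th weight is at most [u]. *)
  rewrite /qbin !ltz_nat lez_nat /=; case: ltnP => // jD.
  have := gen_weight_cap _ _ _ _ _ _ (optimal_anticode_limg _ _ _ _ f um rf) m0 jD.
  by rewrite max_rank_limg // leqNgt uj.
rewrite (dim_cap_anticode _ _ _ u) ?dim_limg_rank // => [N h|].
  by apply: df => X; apply: h; apply/memv_imgP; exists X; rewrite ?memvf ?lfunE.
(* By monotonicity the [i]-th weight is also at most [u], which turns the BMD inequality into
   [n - u < dual_min_dist C]. *)
have := leq_trans (gen_weightS _ _ _ C _ _ ij) uj.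
move: bmd; rewrite /BMD !subr_lt0 ltrBlDr -PoszD ltz_nat => h1 h2.
by rewrite ltn_subLR // (leq_trans h1) // leq_add2r.
Qed.

Section Shortenings.
Variables (F : finFieldType) (n m i j u : nat) (C : {vspace 'M[F]_(n, m)}).
Hypotheses (m0 : (0 < m)%N) (un : (u <= n)%N) (nm : (n <= m)%N)
  (ij : (i <= j)%N) (bmd : BMD i C).

Lemma qbin_col_short (U : {vspace 'rV[F]_n}) : \dim U = u ->
  qbin #|F| (\dim (col_short C U))%:Z j%:Z =
  if (u < gen_weight C j)%N then 0
  else qbin #|F| ((\dim C)%:Z - m%:Z * (n%:Z - u%:Z)) j%:Z.
Proof.
case/rowspace_basis => B fB <-{U}.
apply: (qbin_short F n m u i j C _
  (trmx \o mulmxr B : {linear 'M_(m, u) -> 'M_(n, m)})) => //=.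
- exact: leq_trans nm.
- by move=> X; rewrite mxrank_tr mxrankMfree.
(* The vanishing traces give [B *m N = 0], so the ranks of [B] and [N] add up to at most [n]. *)
- move=> N h; rewrite leq_subRL // -{1}(eqP fB); apply: mulmx0_rank_max.
  apply: tr_mulmx_eq0 => X.
  by rewrite mulmxA -mxtrace_tr trmx_mul mxtrace_mulC h.
- move=> M; rewrite mem_col_short /colspace rowspace_subvE; congr (_ && _).
  apply/submxP/memv_imgP => [[X e]|[X _ ->]]; exists X; rewrite ?memvf ?lfunE //=.
    by rewrite -e trmxK.
  by rewrite trmxK.
Qed.
End Shortenings.

Lemma qbin_row_short (F : finFieldType) (n i j u : nat) (C : {vspace 'M[F]_n})
    (U : {vspace 'rV[F]_n}) :
  (0 < n)%N -> (u <= n)%N -> (i <= j)%N -> BMD i C -> \dim U = u ->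
  qbin #|F| (\dim (row_short C U))%:Z j%:Z =
  if (u < gen_weight C j)%N then 0
  else qbin #|F| ((\dim C)%:Z - n%:Z * (n%:Z - u%:Z)) j%:Z.
Proof.
move=> n0 un ij bmd; case/rowspace_basis => B fB <-{U}.
apply: (qbin_short F n n u i j C _ (mulmxr B : {linear 'M_(n, u) -> 'M_n})) => //=.
- by move=> X; rewrite mxrankMfree.
(* Here the traces give [B *m N^T = 0]. *)
- move=> N h; rewrite leq_subRL // -{1}(eqP fB) -(mxrank_tr N); apply: mulmx0_rank_max.
  by apply: tr_mulmx_eq0 => X; rewrite mulmxA.
- move=> M; rewrite mem_row_short rowspace_subvE; congr (_ && _).
  by apply/submxP/memv_imgP => [[X e]|[X _ ->]]; exists X; rewrite ?memvf ?lfunE.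
Qed.

Theorem lemma4p4 (F : finFieldType) (n m : nat)
  (hn : (2 <= n)%N) (hnm : (n <= m)%N)
  (C : {vspace 'M[F]_(n, m)}) (k : nat) (hk : \dim C = k)
  (i : nat) (hik : (i <= k)%N) (hBMD : BMD i C)
  (j u : nat) (hij : (i <= j)%N) (hjk : (j <= k)%N) (hu : (u <= n)%N) :
  binomial_moment C j u =
    if (u < gen_weight C j)%N then 0
    else qbin #|F| n%:Z u%:Z
         * qbin #|F| (k%:Z - m%:Z * (n%:Z - u%:Z)) j%:Z.
Proof.
have m0 : (0 < m)%N by rewrite (leq_trans _ hnm) // (leq_trans _ hn).
set r := if _ then _ else _.
(* The common contribution of every [U] of dimension [u]; what remains is to count these
   subspaces. *)
pose c := if (u < gen_weight C j)%N then 0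
  else qbin #|F| (k%:Z - m%:Z * (n%:Z - u%:Z)) j%:Z.
have -> : r = qbin #|F| n%:Z u%:Z * c by rewrite /r /c; case: ifP; rewrite ?mulr0.
have sum_c (a : rat) : \sum_(U : {vspace 'rV[F]_n} | \dim U == u) a
    = qbin #|F| n%:Z u%:Z * a.
  by rewrite sumr_const -card_subspaces // cardsE mulr_natl.
have col U : \dim U = u -> qbin #|F| (\dim (col_short C U))%:Z j%:Z = c.
  by move=> dU; rewrite (qbin_col_short F n m i j u) ?hk.
rewrite /binomial_moment; case: ltnP => mn.
  by rewrite -sum_c; apply: eq_bigr => U /eqP /col.
have e : m = n by apply/eqP; rewrite eqn_leq mn.
(* Column and row shortenings each contribute [c], and the factor 1/2 cancels the doubling. *)
subst m; under eq_bigr => U /eqP dU.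
  rewrite (col U dU) (qbin_row_short F n i j u) // hk -/c; over.
by rewrite sum_c -mulr2n -(mulr_natl c) mulrCA mulKf.
Qed.
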